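(* Let $R$ be a reduced extended affine root system and let $P$ be in any of $\mathcal M_c$, $\mathcal M_m$ or $\mathcal M_r$. Then $P$ is finite.
   Context: All vector spaces are finite-dimensional and real. Let $\mathcal V$ be a vector space with a positive semidefinite symmetric bilinear form $(\cdot,\cdot)$ with radical $\mathcal V^0$. For $R\subseteq\mathcal V$ put $R^0=R\cap\mathcal V^0$, $R^\times=R\setminus R^0$. For $(\alpha,\alpha)\ne0$ put $\alpha^\vee=2\alpha/(\alpha,\alpha)$, $w_\alpha(\beta)=\beta-(\beta,\alpha^\vee)\alpha$. $\langle A\rangle$ is the additive subgroup generated by $A$. $P\subseteq\mathcal V\setminus\mathcal V^0$ is connected if it is not a disjoint union of nonempty $P_1,P_2$ with $(P_1,P_2)=\{0\}$. $R$ is an extended affine root system if: $\langle R\rangle$ is a full lattice in $\mathcal V$; $(\beta,\alpha^\vee)\in\mathbb Z$ for $\alpha,\beta\in R^\times$; $w_\alpha(\beta)\in R$ for $\alpha\in R^\times,\beta\in R$; $R^0=\mathcal V^0\cap(R^\times-R^\times)$; $\alpha\in R^\times\Rightarrow2\alpha\notin R$; $R^\times$ is connected. In particular $R^\times\ne\emptyset$. The image $\bar R$ of $R$ in $\mathcal V/\mathcal V^0$ is an irreducible finite root system (containing $0$); $R$ is reduced if $\bar R$ is. Weyl group: there is a finite root system $\dot R\subseteq R$ mapping isometrically onto $\bar R$ with $\mathcal V=\dot{\mathcal V}\oplus\mathcal V^0$, $\dot{\mathcal V}=\mathrm{span}\,\dot R$. Put $\tilde{\mathcal V}=\dot{\mathcal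 V}\oplus\mathcal V^0\oplus(\mathcal V^0)^*$ and extend the form by $(\dot{\mathcal V},(\mathcal V^0)^* )=((\mathcal V^0)^*,(\mathcal V^0)^* )=\{0\}$, $(\sigma,\lambda)=\lambda(\sigma)$. $\mathcal W\le GL(\tilde{\mathcal V})$ is generated by $w_\alpha:\beta\mapsto\beta-(\beta,\alpha^\vee)\alpha$, $\alpha\in R^\times$; $\mathcal W_P$ is the subgroup generated by $w_\alpha$, $\alpha\in P$. $\mathcal M_r$ is the class of reflectable bases: $P\subseteq R^\times$ with $\mathcal W_PP=R^\times$ such that no proper subset $P'$ of $P$ satisfies $\mathcal W_{P'}P'=R^\times$. $\mathcal M_m$ is the class of $P\subseteq R^\times$ minimal under inclusion with respect to $\mathcal W_P=\mathcal W$. $\mathcal M_c$ is the class of $P\subseteq R^\times$ with $\mathcal W_P=\mathcal W$ and $|P|=c$, where $c$ is the least number (cardinality) of reflections $w_\alpha$ ($\alpha\in R^\times$) generating $\mathcal W$. *)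

(* Defs.v *)
From HB Require Import structures.
From mathcomp Require Import all_boot all_order all_algebra finmap.
From mathcomp Require Import all_classical all_reals.
From mathcomp Require Import ring.

Set Implicit Arguments.
Unset Strict Implicit.
Unset Printing Implicit Defensive.

Import Order.TTheory GRing.Theory Num.Theory.
Local Open Scope classical_set_scope.
Local Open Scope card_scope.
Local Open Scope ring_scope.

Section Generated.
Context (K : realType) (U : vectType K).
Implicit Types (A L : set U) (H G : set 'End(U)).

Definition additive_subgroup A : Prop :=
  A 0 /\ forall x y, A x -> A y -> A (x - y).

Definition additive_span A : set U := smallest additive_subgroup A.

(* L is the Z-span of an R-basis of U. *)
Definition full_lattice L : Prop :=
  exists2 b : seq U, basis_of fullv b & L = additive_span [set` b].

Definition GL_subgroup H : Prop :=
  [/\ H `<=` [set g | lker g == 0%VS], H \1%VF,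
      forall g h, H g -> H h -> H (g \o h)%VF
    & forall g, H g -> H (g^-1)%VF].

Definition generated_group G : set 'End(U) := smallest GL_subgroup G.

End Generated.

Section Reflection.
Context (K : realType) (U : vectType K) (B : {symmetric U}).
Implicit Types a b : U.

Definition coroot a : U := (2 / B a a) *: a.

Definition reflection a b : U := b - B b (coroot a) *: a.

Fact reflection_is_linear a : linear (reflection a).
Proof.
move=> k x y; rewrite /reflection linearPl/= scalerBr scalerDl scalerA opprD.
by rewrite addrACA.
Qed.

HB.instance Definition _ a :=
  GRing.isLinear.Build K U U *:%R (reflection a) (reflection_is_linear a).

End Reflection.

Section ExtendedAffineRootSystem.
Context (K : realType) (V : vectType K) (B : {symmetric V}).
Implicit Types (R P : set V) (dR : {fset V}) (W : {vspace V}).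

Definition positive_semidefinite : Prop := forall x, 0 <= B x x.

Definition radical : {vspace V} := orthov B fullv.

Definition isotropic_part R : set V := R `&` [set x | x \in radical].

Definition nonisotropic_part R : set V := R `\` [set x | x \in radical].

Definition connected_roots P : Prop :=
  ~ exists P1 P2 : set V,
      [/\ P1 !=set0, P2 !=set0, P1 `|` P2 = P, P1 `&` P2 = set0
        & forall a b, P1 a -> P2 b -> B a b = 0].

Record extended_affine_root_system R : Prop := {
  ears_nonempty : nonisotropic_part R !=set0;
  ears_lattice : full_lattice (additive_span R);
  ears_integral : forall a b, nonisotropic_part R a -> nonisotropic_part R b ->
    B b (coroot B a) \is a Num.int;
  ears_reflection : forall a b, nonisotropic_part R a -> R b ->
    R (reflection B a b);
  ears_isotropic : isotropic_part R =
    [set x | x \in radical] `&`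
    [set a - b | a in nonisotropic_part R & b in nonisotropic_part R];
  ears_double : forall a, nonisotropic_part R a -> ~ R (2 *: a);
  ears_connected : connected_roots (nonisotropic_part R)
}.

(* The quotient of V by the radical is realized by cosets: [coset v] is the
   class of v, so that [coset (2 *: v)] is twice that class. *)
Definition coset (v : V) : set V := [set u | u - v \in radical].

Definition bar R : set (set V) := coset @` R.

(* The finite root system [bar R] is reduced: twice a nonzero root is never a
   root. *)
Definition reduced R : Prop :=
  forall a, nonisotropic_part R a -> ~ bar R (coset (2 *: a)).

(* A root system contains 0; its ambient space is its span. *)
Definition finite_root_system dR : Prop :=
  [/\ 0 \in dR,
      forall x, x \in <<dR>>%VS -> x != 0 -> 0 < B x x,
      forall a b, a \in dR -> b \in dR -> a != 0 ->
        B b (coroot B a) \is a Num.int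
    & forall a b, a \in dR -> b \in dR -> a != 0 -> reflection B a b \in dR].

(* The form of the quotient is (coset a, coset b) := B a b, so that the
   bijection [coset] from dR to [bar R] is isometric. *)
Record finite_lift R dR : Prop := {
  lift_sub : [set` dR] `<=` R;
  lift_root_system : finite_root_system dR;
  lift_bij : set_bij [set` dR] (bar R) coset;
  lift_direct : (<<dR>> :&: radical = 0)%VS;
  lift_full : (<<dR>> + radical = fullv)%VS
}.

(* Since V is the direct sum of W = <<dR>> and the radical, the hyperbolic
   extension is V plus the dual of the radical. *)
Definition tilde : vectType K := (V * 'Hom(subvs_of radical, K^o))%type.

Definition embed (v : V) : tilde := (v, 0).

(* Component in the radical for the decomposition of V as W + radical *)
Definition radical_component W (v : V) : subvs_of radical :=
  vsproj radical (daddv_pi radical W v).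

Definition tilde_form W (x y : tilde) : K :=
  B x.1 y.1 + y.2 (radical_component W x.1) + x.2 (radical_component W y.1).

Fact radical_component_is_linear W : linear (radical_component W).
Proof. by move=> k x y; rewrite /radical_component !linearP. Qed.

HB.instance Definition _ W :=
  GRing.isLinear.Build K V (subvs_of radical) *:%R (radical_component W)
    (radical_component_is_linear W).

Fact tilde_form_sym W x y :
  tilde_form W x y = (-1) ^+ false * idfun (tilde_form W y x).
Proof.
by rewrite expr0 mul1r /tilde_form /= (hermC _ x.1) /= expr0 mul1r addrAC.
Qed.

Fact tilde_form_bilinear W :
  bilinear_for *%R (idfun \; *%R : K -> K -> K) (tilde_form W).
Proof.
have lin x k y z :
    tilde_form W x (k *: y + z) = k * tilde_form W x y + tilde_form W x z.
  have lin_x2 a b : x.2 (k *: a + b) = k * x.2 a + x.2 b by exact: linearP.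
  have lin_2 a : (k *: y + z).2 a = k * y.2 a + z.2 a.
    by rewrite /= add_lfunE scale_lfunE.
  rewrite /tilde_form lin_2 /= linearPr linearP lin_x2/=.
  move: (x.2 _) (x.2 _) (y.2 _) (z.2 _) => p q r s; rewrite /K^o in p q r s *.
  by ring.
split=> u k y z; last exact: lin.
by rewrite /= ![tilde_form W _ u]tilde_form_sym !expr0 !mul1r /= lin.
Qed.

HB.instance Definition _ W :=
  bilinear_isBilinear.Build K tilde tilde K *%R (idfun \; *%R)
    (tilde_form W) (tilde_form_bilinear W).

HB.instance Definition _ W :=
  isHermitianSesquilinear.Build K tilde false idfun (tilde_form W)
    (tilde_form_sym W).

Definition tilde_reflection W (a : V) : 'End(tilde) :=
  linfun (reflection (tilde_form W) (embed a)).

Definition weyl W P : set 'End(tilde) :=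
  generated_group (tilde_reflection W @` P).

(* In the three classes below, R is the ambient root system and W the chosen
   complement of the radical, through which the Weyl group acts on [tilde]. *)

Definition weyl_orbits W P : set tilde :=
  [set g (embed a) | g in weyl W P & a in P].

Definition reflectable W R P : Prop :=
  weyl_orbits W P = embed @` nonisotropic_part R.

Definition class_r W R P : Prop :=
  [/\ P `<=` nonisotropic_part R, reflectable W R P
    & forall P', P' `<` P -> ~ reflectable W R P'].

Definition generates_weyl W R P : Prop :=
  weyl W P = weyl W (nonisotropic_part R).

Definition class_m W R P : Prop :=
  [/\ P `<=` nonisotropic_part R, generates_weyl W R P
    & forall P', P' `<` P -> ~ generates_weyl W R P'].

(* S is a generating set of reflections of least cardinality, so that its
   cardinality is the number c. Several roots define the same reflection, so
   that c counts reflections rather than roots. *)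
Definition least_generating_reflections W R (S : set 'End(tilde)) : Prop :=
  let refls := tilde_reflection W @` nonisotropic_part R in
  let generating (S' : set 'End(tilde)) :=
    S' `<=` refls /\ generated_group S' = weyl W (nonisotropic_part R) in
  generating S /\ forall S', generating S' -> S #<= S'.

Definition class_c W R P : Prop :=
  [/\ P `<=` nonisotropic_part R, generates_weyl W R P
    & exists2 S, least_generating_reflections W R S & P #= S].

End ExtendedAffineRootSystem.

(* Main.v *)
Require Import Defs.
From HB Require Import structures.
From mathcomp Require Import all_boot all_order all_algebra finmap.
From mathcomp Require Import all_classical all_reals.
From mathcomp Require Import ring.

Set Implicit Arguments.
Unset Strict Implicit.
Unset Printing Implicit Defensive.

Import Order.TTheory GRing.Theory Num.Theory.
Local Open Scope classical_set_scope.
Local Open Scope ring_scope.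

(** Everything follows from the existence of a finite set [P0] of roots whose
    orbits under its own reflections exhaust the nonisotropic roots
    ([finite_reflectable]).

    To find [P0], fix a nonzero root [a] of the finite root system [dR] and let
    [S] be the set of the radical vectors [s] such that [a + s] is a root.  The
    reflections in [a] and [a + s] fix the radical and compose to the
    translation by [2 s] or [- 2 s] on the coset of [a]
    ([reflection_translate]).  Hence, if [a] and the [a + s], for [s] in a
    subset [F] of [S], belong to [P0], then the orbits of [P0] in this coset
    are stable under the doubles of the group generated by [F]
    ([weyl_orbits_translate]).  Since [R] spans a lattice, [S] generates a
    finitely generated group; some finite [F] in [S] generates that group and
    moreover represents [S] modulo its doubles
    ([finite_representatives_mod2]), and this [F] reaches all of [a + S].
    Finally [dR] is finite, and every nonisotropic root is some [a + s].

    The reflection in [g a] is the conjugate by [g] of the reflection in [a], so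
    a set of roots with full orbits generates the Weyl group
    ([reflectable_generates]).  Thus the finitely many reflections in [P0]
    generate the Weyl group, which bounds the least number of generating
    reflections and settles the first class.  When [P] generates the Weyl
    group, each reflection in [P0] is a product of finitely many reflections in
    [P], so a finite subset of [P] already generates
    ([finite_generating_subset]); by minimality it is [P] in the second class.
    For a reflectable basis, [P0] also shows that there are finitely many
    orbits of roots, and a finite generating subset of [P] together with one
    root of [P] in each orbit is reflectable, hence equal to [P]. *)

(** * Finitary closure operators *)

(** Used for the additive span, for the Weyl group of a set of roots, and for
    unions of orbits. *)
Lemma finite_sub_closure (T U : choiceType) (cl : set T -> set U) (A : set T)
    (G : set U) :
  (forall A1 A2, A1 `<=` A2 -> cl A1 `<=` cl A2) ->
  (forall x, cl A x -> exists F, [/\ finite_set F, F `<=` A & cl F x]) ->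
  finite_set G -> G `<=` cl A ->
  exists F, [/\ finite_set F, F `<=` A & G `<=` cl F].
Proof.
move=> cl_mono cl_fin finG GA.
have /boolp.choice[f fP] x : exists F : set T, G x ->
    [/\ finite_set F, F `<=` A & cl F x].
  have [Gx|nGx] := pselect (G x); last by exists set0.
  by have [F FP] := cl_fin x (GA x Gx); exists F.
exists (\bigcup_(x in G) f x); split.
- by apply: bigcup_finite => // x /fP[].
- by move=> y [x /fP[_ + _]]; apply.
- move=> x Gx; have [_ _] := fP x Gx; apply: cl_mono.
  exact: bigcup_sup.
Qed.

(** * Finitely generated additive subgroups *)

Lemma int_euclid (k : int) (n : nat) : exists q r : int,
  [/\ k = q * n.+1%:Z + r, 0 <= r & r < n.+1%:Z].
Proof.
exists (k %/ n.+1%:Z)%Z, (k %% n.+1%:Z)%Z.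
by rewrite -divz_eq modz_ge0 // ltz_pmod.
Qed.

Section AdditiveSpan.
Context (K : realType) (U : vectType K).
Implicit Types (A S H : set U) (s t : seq U).

Lemma additive_span_subgroup A : additive_subgroup (additive_span A).
Proof.
split=> [H [[]]//|x y Ax Ay H [Hsub AH]].
by apply: Hsub.2; [apply: Ax|apply: Ay].
Qed.

Lemma additive_span0 A : additive_span A 0.
Proof. by case: (additive_span_subgroup A). Qed.

Lemma additive_spanB A x y :
  additive_span A x -> additive_span A y -> additive_span A (x - y).
Proof. by case: (additive_span_subgroup A) => _; apply. Qed.

Lemma mem_additive_span A x : A x -> additive_span A x.
Proof. by move=> Ax H [_]; apply. Qed.

Lemma additive_spanS A1 A2 :
  A1 `<=` A2 -> additive_span A1 `<=` additive_span A2.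
Proof. exact: sub_smallest2r (additive_span_subgroup A2). Qed.

Section Subgroup.
Context (H : set U) (Hsub : additive_subgroup H).

Lemma additive_subgroupN x : H x -> H (- x).
Proof. by move=> Hx; rewrite -sub0r; apply: Hsub.2 => //; apply: Hsub.1. Qed.

Lemma additive_subgroupD x y : H x -> H y -> H (x + y).
Proof.
by move=> Hx Hy; rewrite -[y]opprK; apply: Hsub.2 => //;
  apply: additive_subgroupN.
Qed.

Lemma additive_subgroupMz x (k : int) : H x -> H (x *~ k).
Proof.
move=> Hx; have HMn n : H (x *+ n).
  elim: n => [|n IHn]; first by rewrite mulr0n; apply: Hsub.1.
  by rewrite mulrS; apply: additive_subgroupD.
by case: k => n; [|apply: additive_subgroupN]; apply: HMn.
Qed.

End Subgroup.

Lemma additive_span_ind A H x :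
  additive_subgroup H -> A `<=` H -> additive_span A x -> H x.
Proof. by move=> Hsub AH; apply: smallest_sub. Qed.

Lemma additive_span_finitary A x : additive_span A x ->
  exists F, [/\ finite_set F, F `<=` A & additive_span F x].
Proof.
apply: (@additive_span_ind A
  [set x | exists F, [/\ finite_set F, F `<=` A & additive_span F x]]).
- split=> [|u v [F [finF FA Fu]] [G [finG GA Gv]]].
    by exists set0; split => //; apply: additive_span0.
  exists (F `|` G); split; first by rewrite finite_setU.
    by move=> y [/FA|/GA].
  apply: additive_spanB.
    exact: additive_spanS Fu.
  exact: additive_spanS Gv.
- move=> a Aa; exists [set a]; split => //; first by move=> _ ->.
  exact: mem_additive_span.
Qed.

Lemma additive_span_cons b s x : additive_span [set` b :: s] x ->
  exists k : int, additive_span [set` s] (x - b *~ k).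
Proof.
apply: (@additive_span_ind _
  [set x | exists k : int, additive_span [set` s] (x - b *~ k)]).
- split=> [|u v [k ku] [l lv]].
    by exists 0; rewrite mulr0z subr0; apply: additive_span0.
  exists (k - l); rewrite mulrzBr opprD addrACA -opprD.
  exact: additive_spanB.
- move=> a /=; rewrite inE => /orP[/eqP->|sa].
    by exists 1; rewrite mulr1z subrr; apply: additive_span0.
  by exists 0; rewrite mulr0z subr0; apply: mem_additive_span.
Qed.

Lemma additive_span_nil x : additive_span [set` ([::] : seq U)] x -> x = 0.
Proof.
apply: (@additive_span_ind _ [set 0]); last by move=> y.
by split=> // u v /= -> ->; rewrite subr0.
Qed.

(** Subgroups of a finitely generated abelian group are finitely generated.  By
    induction on the number of generators: the coefficients along the first
    generator [b] of the elements of [H] form an ideal of the integers, so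
    that one element [h0] of [H] with the smallest positive coefficient
    complements generators of the part of [H] that does not involve [b]. *)
Lemma additive_subgroup_fg s H :
  additive_subgroup H -> H `<=` additive_span [set` s] ->
  exists2 t : seq U, [set` t] `<=` H & H `<=` additive_span [set` t].
Proof.
elim: s H => [|b s IHs] H Hsub Hs.
  exists [::] => [x|x /Hs /additive_span_nil ->]; first by rewrite /= in_nil.
  exact: additive_span0.
have sSub := additive_span_subgroup [set` s].
have [t tH Ht] : exists2 t : seq U, [set` t] `<=` H `&` additive_span [set` s] &
    H `&` additive_span [set` s] `<=` additive_span [set` t].
  apply: IHs; last by move=> x [].
  split=> [|x y [Hx sx] [Hy sy]]; first by split; [apply: Hsub.1|apply: sSub.1].
  by split; [apply: Hsub.2|apply: sSub.2].
pose coef n := `[< exists2 h, H h & additive_span [set` s] (h - b *+ n.+1) >].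
have [coef_ex|coef0] := pselect (exists n, coef n); last first.
  exists t => [x /tH[]//|x Hx]; apply: Ht; split=> //.
  have [[[|n]|n] xk] := additive_span_cons (Hs _ Hx).
  - by rewrite -[x]subr0 -(mulr0n b).
  - by case: coef0; exists n; apply/asboolP; exists x.
  - case: coef0; exists n; apply/asboolP; exists (- x).
      exact: additive_subgroupN Hsub _ Hx.
    by rewrite -opprD; apply: (additive_subgroupN sSub); rewrite -[b *+ _]opprK.
case: (ex_minnP coef_ex) => n /asboolP[h0 Hh0 sh0] n_min.
have tSub := additive_span_subgroup [set` h0 :: t].
exists (h0 :: t) => [x|x Hx].
  by rewrite /= inE => /orP[/eqP->//|/tH[]].
have [k sk] := additive_span_cons (Hs _ Hx).
have [q [r [kE r_ge0 r_lt]]] := int_euclid k n.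
have Hy : H (x - h0 *~ q).
  by apply: Hsub.2 => //; apply: (additive_subgroupMz Hsub).
have sy : additive_span [set` s] (x - h0 *~ q - b *~ r).
  rewrite (_ : _ - _ = (x - b *~ k) - (h0 - b *+ n.+1) *~ q).
    by apply: sSub.2 => //; apply: (additive_subgroupMz sSub).
  rewrite kE mulrzBl mulrzDr [q * _]mulrC mulrzA -pmulrn opprB.
  by rewrite [_ + b *~ r]addrC opprD [x + (_ - _)]addrA subrKA addrAC.
(* minimality of [n.+1] forces the remainder to vanish *)
have r0 : r = 0.
  case: r {kE} r_ge0 r_lt sy => [[|r]|r]// _; rewrite ltz_nat => rn sy.
  suff /n_min : coef r by rewrite leqNgt -ltnS rn.
  by apply/asboolP; exists (x - h0 *~ q).
rewrite -[x](subrK (h0 *~ q)); apply: (additive_subgroupD tSub); last first.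
  apply: (additive_subgroupMz tSub); apply: mem_additive_span.
  by rewrite /= mem_head.
apply: (@additive_spanS [set` t]); first by move=> y /=; rewrite inE orbC => ->.
by apply: Ht; split=> //; rewrite r0 mulr0z subr0 in sy.
Qed.

(** Coefficients matter only modulo 2, so the sums of the subsequences of [t]
    represent all the classes. *)
Lemma additive_span_mod2 t : exists c : seq U,
  forall x, additive_span [set` t] x ->
  exists2 y, y \in c & exists2 z, additive_span [set` t] z & x = y + z *+ 2.
Proof.
elim: t => [|b t [c IHt]].
  exists [:: 0] => x /additive_span_nil ->; exists 0; rewrite ?mem_head //.
  exists 0; first exact: additive_span0.
  by rewrite mul0rn addr0.
exists (c ++ [seq b + y | y <- c]) => x /additive_span_cons[k /IHt].
move=> [y cy [z tz xE]].
have tSub := additive_span_subgroup [set` b :: t].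
have [q [r [kE r_ge0 r_lt]]] := int_euclid k 1.
have bqz : additive_span [set` b :: t] (b *~ q + z).
  apply: (additive_subgroupD tSub).
    apply: (additive_subgroupMz tSub); apply: mem_additive_span.
    by rewrite /= mem_head.
  by apply: additive_spanS tz => u /=; rewrite inE orbC => ->.
have xr : x = (b *~ r + y) + (b *~ q + z) *+ 2.
  rewrite -[x](subrK (b *~ k)) xE kE mulrzDr mulrnDl mulrzA addrC.
  by rewrite [_ + b *~ r]addrC addrACA.
case: r {kE} r_ge0 r_lt xr => [[|[|r]]|r]// _ _ xr.
- exists y; first by rewrite mem_cat cy.
  by exists (b *~ q + z); rewrite // xr mulr0z add0r.
- exists (b + y); first by rewrite mem_cat map_f ?orbT.
  by exists (b *~ q + z).
Qed.

(** [F] is the union of a finite part [G] of [S] that generates the same group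
    as [S], and of one element of [S] in each of the finitely many classes
    modulo the doubles of that group that meet [S]. *)
Lemma finite_representatives_mod2 s S : S `<=` additive_span [set` s] ->
  exists F, [/\ finite_set F, F `<=` S & forall x, S x ->
    exists2 y, F y & exists2 z, additive_span F z & x = y + z *+ 2].
Proof.
move=> Ss; have [|t tS St] := additive_subgroup_fg
  (additive_span_subgroup S) (s := s).
  by move=> x; apply: additive_span_ind => //; apply: additive_span_subgroup.
have [G [finG GS tG]] : exists G, [/\ finite_set G, G `<=` S &
    [set` t] `<=` additive_span G].
  apply: (finite_sub_closure (cl := @additive_span K U)) => //.
  - exact: additive_spanS.
  - exact: additive_span_finitary.
  - exact: finite_seq.
have SG x : S x -> additive_span [set` t] x by move=> /mem_additive_span /St.
have [c cP] := additive_span_mod2 t.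
(* [f y] is an element of [S] in the class of [y], when there is one *)
have /boolp.choice[f fP] y : exists u, forall x z, S x ->
    additive_span [set` t] z -> x = y + z *+ 2 ->
    S u /\ exists2 z', additive_span [set` t] z' & u = y + z' *+ 2.
  have [[u [z [Su tz uE]]]|nu] := pselect (exists u z,
      [/\ S u, additive_span [set` t] z & u = y + z *+ 2]).
    by exists u => *; split=> //; exists z.
  by exists 0 => x z Sx tz xE; case: nu; exists x, z.
exists (G `|` (f @` [set` c] `&` S)); split.
- rewrite finite_setU; split=> //.
  by apply: finite_setIl; apply: finite_image; apply: finite_seq.
- by move=> x [/GS|[]].
move=> x Sx; have [y cy [z tz xE]] := cP _ (SG x Sx).
have [Sfy [z' tz' fyE]] := fP _ _ _ Sx tz xE.
exists (f y); first by right; split => //; exists y.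
exists (z - z').
  apply: (@additive_spanS G) => //; apply: additive_span_ind tG _.
    exact: additive_span_subgroup.
  exact: additive_spanB.
by rewrite xE fyE mulrnBl -addrA [z' *+ 2 + _]addrCA subrr addr0.
Qed.

End AdditiveSpan.

(** * Generated linear groups *)

Section GeneratedGroup.
Context (K : realType) (U : vectType K).
Implicit Types (G H : set 'End(U)) (g h : 'End(U)).

Lemma GL_subgroup_GL : GL_subgroup [set g : 'End(U) | lker g == 0%VS].
Proof.
split=> //= [|g h /lker0P g_inj /lker0P h_inj|g g_inv]; apply/lker0P.
- by move=> x y; rewrite !id_lfunE.
- by move=> x y; rewrite !comp_lfunE => /g_inj /h_inj.
- exact: can_inj (lker0_lfunVK g_inv).
Qed.

Lemma generated_group_ind G H g :
  GL_subgroup H -> G `<=` H -> generated_group G g -> H g.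
Proof. by move=> Hsub GH; apply: smallest_sub. Qed.

Lemma mem_generated_group G g : G g -> generated_group G g.
Proof. by move=> Gg H [_]; apply. Qed.

Lemma generated_groupS G H :
  G `<=` H -> generated_group G `<=` generated_group H.
Proof. by move=> GH g Gg M [Msub HM]; apply: Gg; split=> // h /GH /HM. Qed.

(** Invertibility of [G] is what makes the intersection defining
    [generated_group G] run over at least one group; an empty intersection
    would contain singular endomorphisms. *)
Lemma generated_group_subgroup G :
  G `<=` [set g | lker g == 0%VS] -> GL_subgroup (generated_group G).
Proof.
move=> G_inv; split.
- by move=> g; apply: (generated_group_ind GL_subgroup_GL).
- by move=> H [[]].
- by move=> g h Gg Gh H HG; have [[_ _ HM _] _] := HG;
    apply: HM; [apply: Gg|apply: Gh].
- by move=> g Gg H HG; have [[_ _ _ HV] _] := HG; apply: HV; apply: Gg.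
Qed.

Lemma generated_group_finitary G g :
  G `<=` [set g | lker g == 0%VS] -> generated_group G g ->
  exists F, [/\ finite_set F, F `<=` G & generated_group F g].
Proof.
move=> G_inv; apply: (@generated_group_ind _
  [set g | exists F, [/\ finite_set F, F `<=` G & generated_group F g]]).
- have F_group F : F `<=` G -> GL_subgroup (generated_group F).
    by move=> FG; apply: generated_group_subgroup => h /FG /G_inv.
  split.
  + by move=> h [F [_ /F_group[Finv _ _ _] /Finv]].
  + by exists set0; split => //; have [] := F_group set0 (@sub0set _ G).
  + move=> h1 h2 [F1 [finF1 F1G Fh1]] [F2 [finF2 F2G Fh2]].
    have FG : F1 `|` F2 `<=` G by move=> h [/F1G|/F2G].
    exists (F1 `|` F2); split; rewrite ?finite_setU //.
    have [_ _ FM _] := F_group _ FG; apply: FM.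
      by apply: generated_groupS Fh1 => h; left.
    by apply: generated_groupS Fh2 => h; right.
  + move=> h [F [finF FG Fh]]; exists F; split=> //.
    by have [_ _ _ FV] := F_group _ FG; apply: FV.
- move=> h Gh; exists [set h]; split=> [//|_ -> //|].
  exact: mem_generated_group.
Qed.

Lemma GL_subgroup_stabilizer (X : set U) :
  GL_subgroup [set g : 'End(U) | lker g == 0%VS /\ forall x, X (g x) <-> X x].
Proof.
have [_ GL1 GLM GLV] := GL_subgroup_GL.
split=> [g []|||] //.
- by split=> // x; rewrite id_lfunE.
- move=> g h [g_inv gX] [h_inv hX]; split; first exact: GLM.
  by move=> x; rewrite comp_lfunE gX hX.
- move=> g [g_inv gX]; split; first exact: GLV.
  by move=> x; rewrite -gX lker0_lfunVK.
Qed.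

Lemma GL_subgroup_isometries (B : {symmetric U}) :
  GL_subgroup [set g : 'End(U) | lker g == 0%VS /\
    forall x y, B (g x) (g y) = B x y].
Proof.
have [_ GL1 GLM GLV] := GL_subgroup_GL.
split=> [g []|||] //.
- by split=> // x y; rewrite !id_lfunE.
- move=> g h [g_inv gB] [h_inv hB]; split; first exact: GLM.
  by move=> x y; rewrite !comp_lfunE gB hB.
- move=> g [g_inv gB]; split; first exact: GLV.
  by move=> x y; rewrite -gB !lker0_lfunVK.
Qed.

End GeneratedGroup.

(** * Reflections *)

Section Reflections.
Context (K : realType) (U : vectType K) (B : {symmetric U}).
Implicit Types a b x y : U.

Lemma symmetricC x y : B x y = B y x.
Proof. by rewrite hermC /= expr0 mul1r. Qed.

Lemma reflectionE a b : reflection B a b = b - (2 / B a a * B b a) *: a.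
Proof. by rewrite /reflection /coroot linearZr. Qed.

Lemma reflection_form a b c :
  B (reflection B a b) c = B b c - 2 / B a a * B b a * B a c.
Proof. by rewrite reflectionE linearBl linearZl_LR. Qed.

Lemma reflectionK a : B a a != 0 -> involutive (reflection B a).
Proof.
move=> aa b; rewrite [LHS]reflectionE reflection_form reflectionE.
rewrite -addrA -opprD -scalerDl (_ : _ * _ + _ = 0) ?scale0r ?subr0 //.
by field.
Qed.

Lemma reflection_isometry a x y : B a a != 0 ->
  B (reflection B a x) (reflection B a y) = B x y.
Proof.
move=> aa; rewrite reflection_form ![B _ (reflection _ _ _)]symmetricC.
rewrite !reflection_form (symmetricC y x) ?(symmetricC a x) ?(symmetricC a y).
by field.
Qed.

Lemma reflection_isometry_comp (g : 'End(U)) a x :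
  (forall x y, B (g x) (g y) = B x y) ->
  reflection B (g a) (g x) = g (reflection B a x).
Proof.
by move=> gB; rewrite !reflectionE !gB [in RHS]linearB /= [g (_ *: _)]linearZ.
Qed.

Lemma radicalP x : reflect (forall y, B x y = 0) (x \in radical B).
Proof.
apply: (iffP mem_orthovP) => [xB y|xB y _]; last exact: xB.
by apply: xB; rewrite memvf.
Qed.

Lemma form_add_radical x y u v : u \in radical B -> v \in radical B ->
  B (x + u) (y + v) = B x y.
Proof.
move=> /radicalP uB /radicalP vB; rewrite linearDl /= uB addr0.
by rewrite linearDr /= [B x v]symmetricC vB addr0.
Qed.

Lemma reflection_add_radical a s k t : B a a != 0 ->
  s \in radical B -> t \in radical B ->
  reflection B (a + s) (k *: a + t) = - k *: a + (t - (2 * k) *: s).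
Proof.
move=> aa srad trad; rewrite reflectionE !form_add_radical // linearZl_LR /=.
rewrite mulrCA divfK // mulrC scalerDr opprD addrACA -scalerBl.
by congr (_ *: _ + _); ring.
Qed.

(** Modulo the radical both reflections map [a] to [- a], but the one in [a + s]
    shifts the result by twice [s]; the signs cancel in the composite and the
    shift remains. *)
Lemma reflection_translate a s t : B a a != 0 ->
  s \in radical B -> t \in radical B ->
  reflection B (a + s) (reflection B a (a + t)) = a + (t + s *+ 2) /\
  reflection B a (reflection B (a + s) (a + t)) = a + (t - s *+ 2).
Proof.
move=> aa srad trad.
have refl_a k u : u \in radical B ->
    reflection B a (k *: a + u) = - k *: a + u.
  move=> urad; rewrite -{1}[a]addr0 reflection_add_radical ?mem0v //.
  by rewrite scaler0 subr0.
have aE u : a + u = 1 *: a + u by rewrite scale1r.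
rewrite [a + t]aE !(refl_a, reflection_add_radical) //; last first.
  by rewrite rpredB // rpredZ.
by rewrite mulrN mulr1 opprK scaleNr opprK scale1r scaler_nat.
Qed.

End Reflections.

(** * The Weyl group acting on the roots *)

Section Tilde.
Context (K : realType) (V : vectType K) (B : {symmetric V}).
Context (W : {vspace V}).
Implicit Types a b : V.

Lemma tilde_form_embed a b :
  tilde_form W (embed B a) (embed B b) = B a b.
Proof. by rewrite /tilde_form /= !zero_lfunE !addr0. Qed.

Lemma tilde_reflection_embed a b :
  tilde_reflection B W a (embed B b) = embed B (reflection B a b).
Proof.
rewrite lfunE /= !reflectionE /= !tilde_form_embed.
by apply: injective_projections => //=; rewrite scaler0 subr0.
Qed.

Section Nonisotropic.
Context (a : V) (aa : B a a != 0).

Lemma tilde_reflection_inv : lker (tilde_reflection B W a) == 0%VS.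
Proof.
apply/lker0P; apply: (can_inj (g := tilde_reflection B W a)) => x.
by rewrite !lfunE /= reflectionK //= tilde_form_embed.
Qed.

Lemma tilde_reflection_isometry x y :
  tilde_form W (tilde_reflection B W a x) (tilde_reflection B W a y) =
  tilde_form W x y.
Proof. by rewrite !lfunE /= reflection_isometry //= tilde_form_embed. Qed.

End Nonisotropic.
End Tilde.

Section WeylGroup.
Context (K : realType) (V : vectType K) (B : {symmetric V}).
Context (R : set V) (dR : {fset V}).
Context (earsR : extended_affine_root_system B R).
Context (liftR : finite_lift B R dR).
Implicit Types (P F : set V) (a b s : V).

Local Notation Rx := (nonisotropic_part B R).
Local Notation W := <<dR>>%VS.
Local Notation weylW := (@weyl K V B W).
Local Notation orbitsW := (@weyl_orbits K V B W).

(** The lift [dR] meets every coset of a root, and its nonzero elements have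
    positive norm because the form is definite on the span of [dR]. *)
Lemma root_decomposition x : Rx x ->
  exists a s, [/\ a \in dR, B a a != 0, s \in radical B & x = a + s].
Proof.
move=> [Rx' xNrad]; have [_ pos _ _] := lift_root_system liftR.
have [_ _ coset_surj] := lift_bij liftR.
have [a dRa ax] : (coset B @` [set` dR]) (coset B x).
  by apply: coset_surj; exists x.
have xa : x - a \in radical B.
  have : coset B x x by rewrite /coset /= subrr mem0v.
  by rewrite -ax.
exists a, (x - a); split=> //; last by rewrite addrC subrK.
apply: lt0r_neq0; apply: pos; first exact: memv_span.
by apply: contra_notN xNrad => /eqP a0; rewrite a0 subr0 in xa.
Qed.

Lemma nonisotropic_form x : Rx x -> B x x != 0.
Proof.
by move=> /root_decomposition[a [s [_ aa srad ->]]]; rewrite form_add_radical.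
Qed.

Lemma nonisotropic_root x : R x -> B x x != 0 -> Rx x.
Proof.
by move=> Rx' xx; split=> // /radicalP xrad; rewrite xrad eqxx in xx.
Qed.

Lemma nonisotropic_reflection a b : Rx a -> Rx b -> Rx (reflection B a b).
Proof.
move=> Rxa Rxb; apply: nonisotropic_root.
  by apply: (ears_reflection earsR) => //; case: Rxb.
by rewrite reflection_isometry ?nonisotropic_form.
Qed.

Section Subset.
Context (P : set V) (PR : P `<=` Rx).

Lemma tilde_reflections_inv :
  tilde_reflection B W @` P `<=` [set g | lker g == 0%VS].
Proof.
by move=> _ [a /PR Ra <-]; apply/tilde_reflection_inv/nonisotropic_form.
Qed.

Lemma weyl_subgroup : GL_subgroup (weylW P).
Proof. exact: generated_group_subgroup tilde_reflections_inv. Qed.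

Lemma weyl_isometry g (x y : tilde B) : weylW P g ->
  tilde_form W (g x) (g y) = tilde_form W x y.
Proof.
move=> Wg; suff [] : [set g : 'End(tilde B) | lker g == 0%VS /\
    forall x y, tilde_form W (g x) (g y) = tilde_form W x y] g by [].
apply: generated_group_ind Wg; first exact: GL_subgroup_isometries.
move=> _ [a /PR Ra <-]; have aa := nonisotropic_form Ra.
split=> [|u v]; first exact: tilde_reflection_inv.
exact: tilde_reflection_isometry.
Qed.

Lemma weyl_stable g (x : tilde B) : weylW P g ->
  (embed B @` Rx) (g x) <-> (embed B @` Rx) x.
Proof.
move=> Wg; suff [] : [set g : 'End(tilde B) | lker g == 0%VS /\
    forall x, (embed B @` Rx) (g x) <-> (embed B @` Rx) x] g by [].
apply: generated_group_ind Wg; first exact: GL_subgroup_stabilizer.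
move=> _ [a /PR Ra <-]; have aa := nonisotropic_form Ra.
split; first exact: tilde_reflection_inv.
have stable u : (embed B @` Rx) u ->
    (embed B @` Rx) (tilde_reflection B W a u).
  move=> [b Rb <-]; exists (reflection B a b).
    exact: nonisotropic_reflection.
  by rewrite tilde_reflection_embed.
move=> u; split; last exact: stable.
by move=> /stable; rewrite !lfunE /= reflectionK //= tilde_form_embed.
Qed.

Lemma weyl_orbits_sub : orbitsW P `<=` embed B @` Rx.
Proof.
by move=> _ [g Wg [a /PR Ra <-]]; apply/weyl_stable => //; exists a.
Qed.

Lemma weyl_finitary g : weylW P g ->
  exists F, [/\ finite_set F, F `<=` P & weylW F g].
Proof.
move=> /(generated_group_finitary tilde_reflections_inv)[G [finG GP Gg]].
have /boolp.choice[f fP] h : exists a, G h -> P a /\ tilde_reflection B W a = h.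
  have [/GP[a Pa aE]|nGh] := pselect (G h); last by exists 0.
  by exists a.
exists (f @` G); split; first exact: finite_image.
  by move=> _ [h /fP[Pfh _] <-].
apply: generated_groupS Gg => h Gh; have [_ fE] := fP _ Gh.
by exists (f h) => //; exists h.
Qed.

(** Every root is some [g a] with [a] in [P] and [g] generated by [P], and its
    reflection is the conjugate by [g] of the reflection in [a]. *)
Lemma reflectable_generates : reflectable B W R P -> generates_weyl B W R P.
Proof.
move=> PR_refl; apply/seteqP; split.
  by apply: generated_groupS; apply: image_subset.
move=> g Wg; apply: generated_group_ind Wg; first exact: weyl_subgroup.
move=> _ [x Rx' <-].
have [h Wh [a Pa hax]] : orbitsW P (embed B x).
  by rewrite PR_refl; exists x.
have [Winv _ WM WV] := weyl_subgroup.
have h_inv := Winv _ Wh.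
have -> : tilde_reflection B W x = (h \o (tilde_reflection B W a \o h^-1))%VF.
  apply/lfunP => u; rewrite !comp_lfunE !lfunE /= -hax.
  rewrite -[in LHS](lker0_lfunVK h_inv u) reflection_isometry_comp //.
  by move=> v w; apply: weyl_isometry.
apply: (WM) => //; apply: (WM); last exact: WV.
by apply: mem_generated_group; exists a.
Qed.

End Subset.

(** The [s] whose double preserves the reachable points of the coset of [a], in
    both directions, form a group, and [reflection_translate] puts every
    element of [F] into it. *)
Lemma weyl_orbits_translate P F a s t : Rx a -> P `<=` Rx -> P a ->
  F `<=` [set u | u \in radical B /\ P (a + u)] ->
  additive_span F s -> t \in radical B ->
  orbitsW P (embed B (a + t)) -> orbitsW P (embed B (a + (t + s *+ 2))).
Proof.
move=> Ra PR Pa FP Fs trad.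
have [_ _ WM _] := weyl_subgroup PR.
have refl_orbit b v : P b -> orbitsW P (embed B v) ->
    orbitsW P (embed B (reflection B b v)).
  move=> Pb [g Wg [c Pc gc]]; exists (tilde_reflection B W b \o g)%VF.
    by apply: WM => //; apply: mem_generated_group; exists b.
  by exists c => //; rewrite comp_lfunE gc tilde_reflection_embed.
suff [_ trans] : [set s | s \in radical B /\ forall t, t \in radical B ->
    orbitsW P (embed B (a + t)) <-> orbitsW P (embed B (a + (t + s *+ 2)))] s.
  by case: (trans t trad).
apply: additive_span_ind Fs; first split.
- by split=> [|u urad]; rewrite ?mem0v // mul0rn addr0.
- move=> u v [urad uE] [vrad vE]; split=> [|w wrad]; first exact: rpredB.
  have wvrad : w - v *+ 2 \in radical B by rewrite rpredB // rpredMn.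
  have vE' := vE _ wvrad; rewrite subrK in vE'.
  have -> : w + (u - v) *+ 2 = w - v *+ 2 + u *+ 2.
    by rewrite mulrnBl addrA addrAC.
  exact: iff_trans (iff_sym vE') (uE _ wvrad).
move=> u /FP[urad Pau]; split=> // w wrad; split=> aw.
  have [<- _] := reflection_translate (nonisotropic_form Ra) urad wrad.
  by do 2!apply: (refl_orbit) => //.
have wurad : w + u *+ 2 \in radical B by rewrite rpredD // rpredMn.
rewrite -[w](addrK (u *+ 2)).
have [_ <-] := reflection_translate (nonisotropic_form Ra) urad wurad.
by do 2!apply: (refl_orbit) => //.
Qed.

(** For a root [a], the set [S a] lies in the lattice spanned by [R], which
    gives a finite [F a] generating the same group and representing [S a] modulo
    doubles.  The chosen roots are [a] and the [a + s] with [s] in [F a], for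
    the nonzero [a] in [dR]: if [y] in [F a] represents [s], the translations
    carry [a + y] to [a + s]. *)
Lemma finite_reflectable : exists P,
  [/\ finite_set P, P `<=` Rx & reflectable B W R P].
Proof.
have [b _ latticeE] := ears_lattice earsR.
pose S a := [set s | s \in radical B /\ R (a + s)].
have /boolp.choice[F FP] a : exists F, R a -> [/\ finite_set F, F `<=` S a &
    forall x, S a x ->
    exists2 y, F y & exists2 z, additive_span F z & x = y + z *+ 2].
  have [Ra|nRa] := pselect (R a); last by exists set0.
  have Sb : S a `<=` additive_span [set` b].
    move=> s [_ Ras]; rewrite -latticeE -[s](addKr a) addrC.
    by apply: additive_spanB; apply: mem_additive_span.
  by have [F FP] := finite_representatives_mod2 Sb; exists F.
pose D := [set a | a \in dR /\ B a a != 0].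
have DR a : D a -> Rx a.
  by move=> [dRa aa]; apply: nonisotropic_root => //; apply: (lift_sub liftR).
pose P := \bigcup_(a in D) (a |` [set a + s | s in F a]).
have PR : P `<=` Rx.
  move=> _ [a Da [->|[s Fs <-]]]; first exact: DR.
  have [_ FS _] := FP a (DR a Da).1; have [srad Ras] := FS s Fs.
  by apply: nonisotropic_root => //; rewrite form_add_radical //; case: Da.
exists P; split=> //.
- apply: bigcup_finite => [|a Da].
    apply: (@sub_finite_set _ _ [set` dR]); last exact: finite_fset.
    by move=> a [].
  have [finF _ _] := FP a (DR a Da).1.
  by rewrite finite_setU; split; [exact: finite_set1|exact: finite_image].
apply/seteqP; split; first exact: weyl_orbits_sub.
move=> _ [x Rx' <-].
have [a [s [dRa aa srad xE]]] := root_decomposition Rx'.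
have Da : D a by [].
have [_ FS repF] := FP a (DR a Da).1.
have [y Fy [z Fz sE]] : exists2 y, F a y &
    exists2 z, additive_span (F a) z & s = y + z *+ 2.
  by apply: repF; split; rewrite // -xE; case: Rx'.
rewrite xE sE.
apply: (@weyl_orbits_translate P (F a)) => //.
- exact: DR.
- by exists a => //; left.
- move=> u Fu; split; first by have [] := FS u Fu.
  by exists a => //; right; exists u.
- by have [] := FS y Fy.
have [_ W1 _ _] := weyl_subgroup PR.
exists \1%VF => //; exists (a + y); last by rewrite id_lfunE.
by exists a => //; right; exists y.
Qed.

(** * Finiteness of generating sets and of reflectable bases *)

(** Each of the finitely many reflections that generate the Weyl group by
    [finite_reflectable] involves finitely many reflections in [P]. *)
Lemma finite_generating_subset P : P `<=` Rx -> generates_weyl B W R P ->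
  exists F, [/\ finite_set F, F `<=` P & generates_weyl B W R F].
Proof.
move=> PR genP; have [P0 [finP0 P0R reflP0]] := finite_reflectable.
have [F [finF FP GF]] : exists F, [/\ finite_set F, F `<=` P &
    tilde_reflection B W @` P0 `<=` weylW F].
  apply: (finite_sub_closure (cl := weylW)) => //.
  - by move=> A1 A2 A12; apply: generated_groupS; apply: image_subset.
  - by move=> g /(weyl_finitary PR).
  - exact: finite_image.
  - move=> _ [a P0a <-]; rewrite genP; apply: mem_generated_group.
    by exists a => //; apply: P0R.
have FR : F `<=` Rx by move=> a /FP /PR.
exists F; split=> //; apply/seteqP; split.
  by apply: generated_groupS; apply: image_subset.
rewrite -(reflectable_generates P0R reflP0) => g Wg.
by apply: generated_group_ind Wg => //; apply: weyl_subgroup.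
Qed.

Lemma finite_class_c P : class_c B W R P -> finite_set P.
Proof.
move=> [_ _ [S [_ S_least] PS]].
have [P0 [finP0 P0R reflP0]] := finite_reflectable.
apply: (card_le_finite (B := tilde_reflection B W @` P0)).
  rewrite (card_le_eql PS); apply: S_least; split; first exact: image_subset.
  exact: reflectable_generates.
exact: finite_image.
Qed.

Lemma finite_class_m P : class_m B W R P -> finite_set P.
Proof.
move=> [PR genP minP].
have [F [finF FP genF]] := finite_generating_subset PR genP.
have [PF|nPF] := pselect (P `<=` F); first exact: sub_finite_set finF.
by have := minP F (conj FP nPF).
Qed.

(** A finite subset [F] of [P] generates the Weyl group.  Every root is in the
    orbit of a member of [P0], hence of a member of a finite subset [G] of [P]
    reaching all of [P0]; so the union of [F] and [G] is reflectable. *)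
Lemma finite_class_r P : class_r B W R P -> finite_set P.
Proof.
move=> [PR reflP minP].
have [F [finF FP genF]] := finite_generating_subset PR
  (reflectable_generates PR reflP).
have [P0 [finP0 P0R reflP0]] := finite_reflectable.
have [G [finG GP P0G]] : exists G, [/\ finite_set G, G `<=` P &
    embed B @` P0 `<=` [set g (embed B a) | g in weylW Rx & a in G]].
  apply: (finite_sub_closure (cl := fun G : set V =>
    [set g (embed B a) | g in weylW Rx & a in G])).
  - by move=> A1 A2 A12 _ [g Wg [a /A12 ? <-]]; exists g => //; exists a.
  - move=> _ [g Wg [a Pa <-]]; exists [set a]; split=> //; first by move=> _ ->.
    by exists g => //; exists a.
  - exact: finite_image.
  - rewrite -(reflectable_generates PR reflP) -/(orbitsW P) reflP.
    exact: image_subset.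
have FGP : F `|` G `<=` P by move=> a [/FP|/GP].
have FGR : F `|` G `<=` Rx by move=> a /FGP /PR.
have [PFG|nPFG] := pselect (P `<=` F `|` G).
  by apply: sub_finite_set PFG _; rewrite finite_setU.
case: (minP _ (conj FGP nPFG)).
have genFG : weylW (F `|` G) = weylW Rx.
  apply/seteqP; split; first by apply: generated_groupS; apply: image_subset.
  by rewrite -genF; apply: generated_groupS; apply: image_subset => a; left.
apply/seteqP; split; first exact: weyl_orbits_sub.
rewrite -reflP0 => _ [g Wg [a P0a <-]].
have [|h Wh [c Gc <-]] := P0G (embed B a); first by exists a.
have [_ _ WM _] := weyl_subgroup FGR.
exists (g \o h)%VF; last by exists c; [right|rewrite comp_lfunE].
apply: WM; last by rewrite genFG.
by rewrite genFG -(reflectable_generates P0R reflP0).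
Qed.

End WeylGroup.

Theorem corollary4p2p2 (K : realType) (V : vectType K) (B : {symmetric V})
    (R : set V) (dR : {fset V}) (P : set V) :
  positive_semidefinite B ->
  extended_affine_root_system B R ->
  reduced B R ->
  finite_lift B R dR ->
  class_c B <<dR>>%VS R P \/ class_m B <<dR>>%VS R P \/ class_r B <<dR>>%VS R P ->
  finite_set P.
Proof.
move=> _ earsR _ liftR [|[]].
- exact: finite_class_c.
- exact: finite_class_m.
- exact: finite_class_r.
Qed.
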